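(* For all integers $n,m\geq 0$ and any indeterminate $y$, \begin{align*} \sum_{k=0}^{n}\binom{n}{k}Q_{m+k,m}(y+1)^{n-k} &= \sum_{k=0}^{n}\binom{n}{k}I_{m+k}\,y^{n-k},\\ \sum_{k=0}^{n}\binom{n}{k}Q_{m+k,m}\,B_{n-k+1}(y) &= y\sum_{k=0}^{n}\binom{n}{k}I_{m+k}\,B_{n-k}(y),\\ \sum_{k=0}^{n}\binom{n}{k}\binom{y+n-k}{n-k}Q_{m+k,m} &= \sum_{k=0}^{n}\binom{n}{k}\binom{y}{n-k}I_{m+k}. \end{align*}
   Context: An involution of a finite set is a permutation $\sigma$ with $\sigma^2=\mathrm{id}$. For $0\le k\le n$, $Q_{n,k}$ is the number of involutions of $[n+1]=\{1,\dots,n+1\}$ whose largest fixed point is $k+1$. $I_n$ is the number of involutions of $[n]$ ($I_0=1$). $B_k(y)=\sum_{j=0}^k S(k,j)y^j$ is the $k$-th Bell (Touchard) polynomial, where $S(k,j)$ is the Stirling number of the second kind; equivalently $B_k(y)$ is the sum over partitions of $[k]$ of $y^{\#\text{blocks}}$. Binomial coefficients in $y$ are polynomials: $\binom{y}{k}=y(y-1)\cdots(y-k+1)/k!$. *)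

(* Defs.v *)
From mathcomp Require Import all_boot all_order all_fingroup all_algebra.

Set Implicit Arguments.
Unset Strict Implicit.
Unset Printing Implicit Defensive.

Import GRing.Theory.
Local Open Scope ring_scope.

(* The finite set [n] is represented by 'I_n = {0, ..., n-1}, so the element
   k+1 of [n+1] corresponds to the ordinal of value k in 'I_n.+1. *)

Definition is_involution (n : nat) (s : 'S_n) : bool := (s ^+ 2 == 1)%g.

Definition involutions (n : nat) : {set 'S_n} := [set s | is_involution s].

Definition num_involutions (n : nat) : nat := #|involutions n|.

Definition largest_fixpoint (n : nat) (s : 'S_n) (i : 'I_n) : bool :=
  (s i == i) && [forall j : 'I_n, (s j == j) ==> (j <= i)%N].

(* Q_{n,k}; the index k is a plain nat, so Q n k = 0 when k > n. *)
Definition Q (n k : nat) : nat :=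
  #|[set s in involutions n.+1 |
      [exists i : 'I_n.+1, (val i == k) && largest_fixpoint s i]]|.

Definition stirling2 (k j : nat) : nat :=
  #|[set P : {set {set 'I_k}} | partition P [set: 'I_k] & #|P| == j]|.

Definition bell_poly (k : nat) : {poly rat} :=
  \sum_(j < k.+1) (stirling2 k j)%:R * 'X^j.

(* p (p - 1) ... (p - k + 1) / k! *)
Definition binom_poly (p : {poly rat}) (k : nat) : {poly rat} :=
  (k`!%:R : rat)^-1 *: \prod_(i < k) (p - i%:R).

(* Main.v *)
(* Deleting the largest fixed point identifies [Q_{m+k,m}] with the number of
   involutions of [m+k] moving each of the last [k] points, so choosing the
   points moved among the last [n] shows that [I_{m+n}] is the binomial
   transform of [k |-> Q_{m+k,m}].  In a binomial convolution the transform can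
   be shifted to the other factor, where it turns [y^N] into [(y+1)^N],
   [y * B_N] into [B_{N+1}] and [binom(y, N)] into [binom(y+N, N)]. *)
Require Import Defs.
From mathcomp Require Import all_boot all_order all_fingroup all_algebra.

Set Implicit Arguments.
Unset Strict Implicit.
Unset Printing Implicit Defensive.

Import GRing.Theory.
Local Open Scope ring_scope.

(** * Binomial sums, transforms and convolutions *)

(** Pascal's rule in summed form; every later induction over binomial sums goes through it. *)
Lemma sum_binS (R : pzSemiRingType) (n : nat) (f : nat -> R) :
  \sum_(i < n.+2) 'C(n.+1, i)%:R * f i
    = \sum_(i < n.+1) 'C(n, i)%:R * (f i + f i.+1).
Proof.
under [RHS]eq_bigr do rewrite mulrDr.
rewrite big_split /= big_ord_recl bin0 mul1r.
rewrite (eq_bigr (fun i : 'I_n.+1 => 'C(n, i.+1)%:R * f i.+1 + 'C(n, i)%:R * f i.+1));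
  last by move=> i _; rewrite lift0 binS natrD mulrDl.
rewrite big_split /= addrA; congr (_ + _).
rewrite [in RHS]big_ord_recl bin0 mul1r big_ord_recr /= bin_small // mul0r addr0.
by congr (_ + _).
Qed.

Definition binom_transform (R : pzSemiRingType) (f : nat -> R) (n : nat) : R :=
  \sum_(i < n.+1) 'C(n, i)%:R * f i.

Definition binom_conv (R : pzSemiRingType) (a f : nat -> R) (n : nat) : R :=
  \sum_(k < n.+1) 'C(n, k)%:R * a k * f (n - k)%N.

Lemma binom_transformS (R : pzSemiRingType) (f : nat -> R) (n : nat) :
  binom_transform f n.+1
    = binom_transform f n + binom_transform (fun i => f i.+1) n.
Proof.
rewrite /binom_transform sum_binS -big_split /=.
by apply: eq_bigr => i _; rewrite mulrDr.
Qed.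

(** Leibniz rule: shifting a sequence differentiates its exponential generating function. *)
Lemma binom_convS (R : pzSemiRingType) (a f : nat -> R) (n : nat) :
  binom_conv a f n.+1
    = binom_conv a (fun i => f i.+1) n + binom_conv (fun i => a i.+1) f n.
Proof.
rewrite /binom_conv; under eq_bigr => i _ do rewrite -mulrA.
rewrite (sum_binS n (fun i => a i * f (n.+1 - i)%N)) -big_split /=.
by apply: eq_bigr => i _; rewrite mulrDr !mulrA subSS subSn // -ltnS.
Qed.

Lemma eq_binom_conv (R : pzSemiRingType) (a b f g : nat -> R) (n : nat) :
  a =1 b -> f =1 g -> binom_conv a f n = binom_conv b g n.
Proof. by move=> ab fg; apply: eq_bigr => i _; rewrite ab fg. Qed.

Lemma binom_convDl (R : pzSemiRingType) (a b f : nat -> R) (n : nat) :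
  binom_conv (fun i => a i + b i) f n = binom_conv a f n + binom_conv b f n.
Proof.
by rewrite -big_split; apply: eq_bigr => i _; rewrite /= mulrDr mulrDl.
Qed.

Lemma binom_convDr (R : pzSemiRingType) (a f g : nat -> R) (n : nat) :
  binom_conv a (fun i => f i + g i) n = binom_conv a f n + binom_conv a g n.
Proof. by rewrite -big_split; apply: eq_bigr => i _; rewrite /= mulrDr. Qed.

(* On exponential generating functions the transform is multiplication by
   [exp], which may be moved from one factor of the product to the other. *)
Lemma binom_conv_transform (R : pzSemiRingType) (q f : nat -> R) (n : nat) :
  binom_conv (binom_transform q) f n = binom_conv q (binom_transform f) n.
Proof.
elim: n q f => [|n IHn] q f.
  by rewrite /binom_conv /binom_transform !big_ord1 !mul1r.
rewrite !binom_convS IHn.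
rewrite (eq_binom_conv _ (@binom_transformS _ q) (frefl f)) binom_convDl.
rewrite [in RHS](eq_binom_conv _ (frefl q) (@binom_transformS _ f)) binom_convDr.
by rewrite !IHn addrA [binom_conv q _ n + _]addrC.
Qed.

(** * Involutions and their largest fixed point *)

Definition involutions_nofix (n m : nat) : {set 'S_n} :=
  [set s in involutions n | [forall j : 'I_n, (m <= j)%N ==> (s j != j)]].

Lemma lift_perm_fixed (n : nat) (h : 'I_n.+1) (s : 'S_n.+1) :
  s h = h -> exists t : 'S_n, s = lift_perm h h t.
Proof.
(* The default [k] is never reached: [s] is injective and fixes [h], so [s (lift h k)] differs from
   [h]. *)
move=> sh; pose f k := odflt k (unlift h (s (lift h k))).
have lf k : lift h (f k) = s (lift h k).
  rewrite /f; case: unliftP => //= e.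
  by have /perm_inj/eqP := etrans e (esym sh); rewrite eq_sym (negPf (neq_lift _ _)).
have f_inj : injective f.
  by move=> i j /(congr1 (lift h)); rewrite !lf => /perm_inj/lift_inj.
exists (perm f_inj); apply/permP => i.
by case: (unliftP h i) => [j|] ->; rewrite ?lift_perm_id ?lift_perm_lift ?permE ?lf.
Qed.

Lemma lift_perm_inj (n : nat) (h : 'I_n.+1) : injective (lift_perm h h).
Proof.
move=> s t e; apply/permP => i; apply: (@lift_inj _ h).
by rewrite -!(lift_perm_lift h) e.
Qed.

Lemma is_involution_lift (n : nat) (h : 'I_n.+1) (t : 'S_n) :
  is_involution (lift_perm h h t) = is_involution t.
Proof.
rewrite /is_involution expgS expg1 lift_permM expgS expg1 -(lift_perm1 h).
by rewrite (inj_eq (@lift_perm_inj _ h)).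
Qed.

(** Deleting the fixed point [h] of value [m] renumbers the points above [h] as those of value at
    least [m], so maximality of [h] becomes absence of fixed points there. *)
Lemma Q_nofix (n m : nat) : (m <= n)%N -> Q n m = #|involutions_nofix n m|.
Proof.
move=> le_mn; pose h : 'I_n.+1 := Ordinal (le_mn : (m < n.+1)%N).
have lm (j : 'I_n) : (lift h j <= m)%N = ~~ (m <= j)%N.
  rewrite /= /bump; case: (leqP m j) => [mj | /ltnW //].
  by apply/negbTE; rewrite -ltnNge.
rewrite -(card_imset _ (@lift_perm_inj _ h)); apply: eq_card => s.
apply/idP/imsetP => [|[t + ->]].
  rewrite inE => /andP[sI /existsP[i /andP[/eqP im /andP[/eqP si /forallP maxi]]]].
  have eih : i = h by exact: val_inj.
  rewrite eih in si maxi; have [t st] := lift_perm_fixed si.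
  exists t => //; move: sI; rewrite !inE st is_involution_lift => -> /=.
  apply/forallP => j; apply/implyP => mj; apply/negP => /eqP tj.
  have := maxi (lift h j).
  by rewrite st lift_perm_lift tj eqxx lm mj.
rewrite !inE is_involution_lift => /andP[-> /forallP nofix] /=.
apply/existsP; exists h; rewrite eqxx /largest_fixpoint lift_perm_id eqxx /=.
apply/forallP => i; case: (unliftP h i) => [j|] ->; last by rewrite leqnn implybT.
rewrite lift_perm_lift (inj_eq (@lift_inj _ h)) lm.
by have := nofix j; case: (_ <= _)%N => /= [/negPf ->|]; rewrite ?implybT.
Qed.

(** Case split on the point of value [m]: if it is moved, the condition extends down to [m]; if it
    is fixed, it is the largest fixed point. *)
Lemma nofixS (n m : nat) : (m <= n)%N ->
  #|involutions_nofix n.+1 m.+1| = (#|involutions_nofix n.+1 m| + Q n m)%N.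
Proof.
move=> le_mn; pose h : 'I_n.+1 := Ordinal (le_mn : (m < n.+1)%N).
rewrite -(cardsID [set s : 'S_n.+1 | s h == h]) addnC.
congr (_ + _)%N; apply: eq_card => s; rewrite !inE.
  rewrite andbCA andbA andbAC -andbA; congr (_ && _).
  apply/andP/forallP => [[/forallP nofix sh] j|nofix].
    rewrite leq_eqVlt; apply/implyP => /orP[/eqP mj|/(implyP (nofix j))//].
    by rewrite (_ : j = h) //; apply: val_inj.
  split; last exact: (implyP (nofix h)).
  apply/forallP => j; apply/implyP => /ltnW; exact/implyP.
rewrite -andbA; congr (_ && _).
apply/andP/existsP => [[/forallP nofix sh]|[i /andP[/eqP im /andP[si /forallP maxi]]]].
  exists h; rewrite eqxx /largest_fixpoint sh; apply/forallP => j.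
  by rewrite leqNgt; have := nofix j; case: (_ < _)%N => /= [/negPf ->|]; rewrite ?implybT.
have eih : i = h by exact: val_inj.
rewrite eih in si maxi; split=> //; apply/forallP => j.
by have := maxi j; rewrite /= leqNgt; case: (_ < _)%N => //; rewrite implybF.
Qed.

(** The induction on [n] raises [m]: by [nofixS], [Q (m.+1 + k) m.+1] is
    [Q (m + k.+1) m + Q (m + k) m], the summand that [sum_binS] produces. For [n = 0] no point of
    ['I_m] has value at least [m], so every involution counts. *)
Lemma num_involutions_transform (R : pzSemiRingType) (n m : nat) :
  (num_involutions (m + n))%:R = binom_transform (fun k => (Q (m + k) m)%:R : R) n.
Proof.
elim: n m => [|n IHn] m.
  rewrite /binom_transform big_ord1 mul1r !addn0 Q_nofix //; congr _%:R.
  apply: eq_card => s; rewrite !inE; case: (is_involution s) => //=.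
  by apply/esym/forallP => j; rewrite leqNgt ltn_ord.
rewrite -addSnnS IHn /binom_transform.
rewrite (sum_binS n (fun k => (Q (m + k) m)%:R)); apply: eq_bigr => k _.
rewrite Q_nofix ?leq_addr // addSn nofixS ?leq_addr // natrD addrC addnS.
by rewrite -Q_nofix // -addnS leq_addr.
Qed.

(** * Set partitions and Stirling numbers *)

Lemma sum_subset_card (T : finType) (A : {set T}) (F : nat -> nat) :
  (\sum_(B : {set T} | B \subset A) F #|B| = \sum_(i < #|A|.+1) 'C(#|A|, i) * F i)%N.
Proof.
rewrite (partition_big (fun B : {set T} => inord #|B| : 'I_#|A|.+1) xpredT) //=.
apply: eq_bigr => i _; rewrite -cards_draws -sum_nat_const.
apply: eq_big => [B|B /andP[sBA /eqP <-]]; last by rewrite inordK ?ltnS ?subset_leq_card.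
rewrite inE; case: (boolP (B \subset A)) => //= sBA.
by rewrite -(inj_eq val_inj) /= inordK // ltnS subset_leq_card.
Qed.

(** Extends [stirling2] to subsets of any finite type, because the recurrence leads from a set to
    its subsets. *)
Definition card_partitions (T : finType) (A : {set T}) (j : nat) : nat :=
  #|[set P : {set {set T}} | partition P A & #|P| == j]|.

Lemma card_partitions0 (T : finType) (A : {set T}) :
  card_partitions A 0 = (A == set0).
Proof.
have [->|nzA] := eqVneq A set0.
  apply/eqP/cards1P; exists set0; apply/setP => P.
  by rewrite !inE partition_set0 cards_eq0 andbb.
apply/eqP; rewrite cards_eq0; apply/eqP/setP => P; rewrite !inE cards_eq0.
apply/negP => /andP[/cover_partition PA /eqP P0].
by rewrite -PA P0 /cover big_set0 eqxx in nzA.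
Qed.

Lemma card_partitions_set0S (T : finType) (j : nat) :
  card_partitions (set0 : {set T}) j.+1 = 0%N.
Proof.
apply/eqP; rewrite cards_eq0; apply/eqP/setP => P; rewrite !inE partition_set0.
by apply/negP => /andP[/eqP ->]; rewrite cards0.
Qed.

(* Classify the partitions by the complement [B] of the block of [x]. *)
Lemma card_partitionsS (T : finType) (A : {set T}) (x : T) (j : nat) :
  x \in A ->
  card_partitions A j.+1
    = (\sum_(B : {set T} | B \subset A :\ x) card_partitions B j)%N.
Proof.
move=> xA; rewrite /card_partitions -sum1dep_card.
rewrite (partition_big (fun P => A :\: pblock P x) (fun B => B \subset A :\ x)).
  2: move=> P /andP[PA _]; apply: setDS; rewrite sub1set mem_pblock.
  2: by rewrite (cover_partition PA).
apply: eq_bigr => B sBAx; rewrite sum1dep_card.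
have sBA : B \subset A by apply: subset_trans sBAx (subD1set _ _).
have xB : x \notin B by apply/negP => /(subsetP sBAx); rewrite !inE eqxx.
have xAB : x \in A :\: B by rewrite inE xB xA.
have notin P : partition P B -> A :\: B \notin P.
  move=> PB; apply/negP => /(partitionS PB)/subsetP/(_ x xAB).
  exact/negP.
(* Adjoining the block [A :\: B] inverts the removal of the block of [x]; it is injective because
   [A :\: B] contains [x] and is not yet a block. *)
rewrite -[RHS](@card_in_imset _ _ (fun P => (A :\: B) |: P)); last first.
  move=> P P'; rewrite !inE => /andP[PB _] /andP[PB' _] e.
  by rewrite -(setU1K (notin _ PB)) e setU1K ?notin.
apply: eq_card => P; apply/idP/imsetP => [|[P' + ->]].
  rewrite inE => /andP[/andP[PA /eqP Pj] /eqP eB].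
  have xP : x \in cover P by rewrite (cover_partition PA).
  have bP : pblock P x \in P by rewrite pblock_mem.
  have eAB : A :\: B = pblock P x.
    by rewrite -eB setDDr setDv set0U; apply/setIidPr; apply: (partitionS PA).
  exists (P :\ pblock P x); last by rewrite eAB setD1K.
  rewrite inE -eB partitionD1 //=.
  by rewrite (cardsD1 (pblock P x)) bP add1n in Pj; case: Pj => ->.
rewrite !inE => /andP[PB /eqP Pj].
have PA : partition (A :\: B |: P') A.
  have {2}<- : A :\: B :|: B = A by rewrite setUC -{1}(setIidPr sBA) setID.
  apply: partitionU1 => //.
    by apply/set0Pn; exists x.
  by rewrite -setI_eq0 setIC setIDA setIC -setIDA setDv setI0.
rewrite PA cardsU1 notin // Pj eqxx /=.
rewrite (def_pblock (partition_trivIset PA) _ xAB) ?setU11 //.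
by rewrite setDDr setDv set0U (setIidPr sBA).
Qed.

(** Induction on [j] replaces a bijection with an ordinal: both sides obey [card_partitionsS], whose
    summands by induction depend only on [#|B|]. *)
Lemma card_partitions_stirling2 (T : finType) (A : {set T}) (j : nat) :
  card_partitions A j = stirling2 #|A| j.
Proof.
rewrite /stirling2 -/(card_partitions _ j).
elim: j T A => [|j IHj] T A.
  by rewrite !card_partitions0 -!cards_eq0 cardsT card_ord.
have [->|[x xA]] := set_0Vmem A.
  rewrite card_partitions_set0S cards0 (_ : [set: 'I_0] = set0) ?card_partitions_set0S //.
  by apply/setP => -[].
have eA : #|A| = #|A :\ x|.+1 by rewrite (cardsD1 x) xA.
rewrite (card_partitionsS _ xA) eA.
rewrite (@card_partitionsS _ _ ord0) ?inE //.
under eq_bigr => B _ do rewrite IHj.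
under [RHS]eq_bigr => B _ do rewrite IHj.
rewrite !(sum_subset_card _ (fun i => card_partitions [set: 'I_i] j)).
by rewrite [#|_ :\ ord0|](_ : _ = #|A :\ x|) // cardsDS ?subsetT // cards1 cardsT card_ord subn1.
Qed.

Lemma stirling2_S (n j : nat) :
  stirling2 n.+1 j.+1 = (\sum_(i < n.+1) 'C(n, i) * stirling2 i j)%N.
Proof.
rewrite {1}/stirling2 -/(card_partitions _ j.+1) (@card_partitionsS _ _ ord0) ?inE //.
under eq_bigr => B _ do rewrite card_partitions_stirling2.
rewrite (sum_subset_card _ (fun i => stirling2 i j)).
by rewrite cardsDS ?subsetT // cards1 cardsT card_ord subn1.
Qed.

Lemma stirling2_S0 (n : nat) : stirling2 n.+1 0 = 0%N.
Proof.
rewrite /stirling2 -/(card_partitions _ 0) card_partitions0.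
by rewrite -cards_eq0 cardsT card_ord.
Qed.

Lemma stirling2_gt (n j : nat) : (n < j)%N -> stirling2 n j = 0%N.
Proof.
elim: j n => // j IHj [_|n lt_nj].
  rewrite /stirling2 -/(card_partitions _ j.+1) (_ : [set: 'I_0] = set0).
    exact: card_partitions_set0S.
  by apply/setP => -[].
rewrite stirling2_S big1 // => i _.
by rewrite IHj ?muln0 // (leq_trans (ltn_ord i)).
Qed.

(** * Transforms of Bell polynomials, binomial polynomials and powers *)

(** A range independent of [k] lets the double sum in [bell_polyS] be exchanged. *)
Lemma bell_polyE (n k : nat) : (k <= n)%N ->
  bell_poly k = \sum_(j < n.+1) (stirling2 k j)%:R * 'X^j.
Proof.
move=> le_kn; rewrite /bell_poly.
rewrite -!(big_mkord xpredT (fun j => (stirling2 k j)%:R * 'X^j)).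
rewrite [RHS](@big_cat_nat _ _ _ k.+1) //= [X in _ + X]big_nat [X in _ + X]big1 ?addr0 //.
by move=> j /andP[lt_kj _]; rewrite stirling2_gt // mul0r.
Qed.

Lemma bell_polyS (n : nat) :
  bell_poly n.+1 = 'X * binom_transform bell_poly n.
Proof.
(* A nonempty set has no partition into zero blocks; shifting the remaining indices yields the
   factor ['X]. *)
rewrite {1}/bell_poly big_ord_recl stirling2_S0 mul0r add0r.
rewrite /binom_transform; under [in RHS]eq_bigr => i _.
  rewrite (@bell_polyE n) -1?ltnS // mulr_sumr; over.
rewrite exchange_big mulr_sumr; apply: eq_bigr => j _.
rewrite lift0 stirling2_S natr_sum mulr_suml mulr_sumr.
by apply: eq_bigr => i _; rewrite natrM exprS mulrCA !mulrA.
Qed.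

(** Over the denominator (k+1)!, all terms share the product [P] of the [p - i] with [i < k], which
    leaves p + 1 = (p - k) + (k + 1). *)
Lemma binom_polyS (p : {poly rat}) (k : nat) :
  binom_poly (p + 1) k.+1 = binom_poly p k.+1 + binom_poly p k.
Proof.
rewrite /binom_poly big_ord_recl [in RHS]big_ord_recr subr0.
rewrite (eq_bigr (fun i : 'I_k => p - i%:R)) => [|i _]; last first.
  by rewrite lift0 -natr1 opprD addrACA subrr addr0.
set P := \prod_(i < k) _.
have -> : (k`!%:R : rat)^-1 *: P = (k.+1`!%:R : rat)^-1 *: (P * k.+1%:R).
  rewrite mulr_natr -scaler_nat scalerA factS natrM invfM mulrAC mulVf ?mul1r //.
  by rewrite Num.Theory.pnatr_eq0.
by rewrite -scalerDr -mulrDr -natr1 addrA subrK mulrC.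
Qed.

(** The offset [r] is there for the induction, whose step uses both [r] and [r.+1]; the theorem
    takes [r = 0]. *)
Lemma binom_poly_Vandermonde (p : {poly rat}) (n r : nat) :
  binom_poly (p + n%:R) (r + n) = \sum_(i < n.+1) 'C(n, i)%:R * binom_poly p (r + i).
Proof.
elim: n r => [|n IHn] r; first by rewrite big_ord1 mul1r addr0.
rewrite -natr1 addrA addnS binom_polyS -addSn IHn IHn.
rewrite (sum_binS n (fun i => binom_poly p (r + i))) -big_split.
by apply: eq_bigr => i _; rewrite /= mulrDr addrC addnS addSn.
Qed.

Lemma binom_transform_exp (R : comPzSemiRingType) (x : R) (n : nat) :
  binom_transform (fun i => x ^+ i) n = (x + 1) ^+ n.
Proof.
rewrite addrC exprDn; apply: eq_bigr => i _.
by rewrite expr1n mul1r mulr_natl.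
Qed.

Theorem theorem4p3 (n m : nat) :
  [/\ \sum_(k < n.+1) 'C(n, k)%:R * (Q (m + k) m)%:R * ('X + 1) ^+ (n - k)
        = \sum_(k < n.+1) 'C(n, k)%:R * (num_involutions (m + k))%:R
            * 'X ^+ (n - k) :> {poly rat},
      \sum_(k < n.+1) 'C(n, k)%:R * (Q (m + k) m)%:R
          * bell_poly (n - k + 1)
        = 'X * \sum_(k < n.+1) 'C(n, k)%:R * (num_involutions (m + k))%:R
            * bell_poly (n - k)
    & \sum_(k < n.+1) 'C(n, k)%:R * binom_poly ('X + (n - k)%:R) (n - k)
          * (Q (m + k) m)%:R
        = \sum_(k < n.+1) 'C(n, k)%:R * binom_poly 'X (n - k)
            * (num_involutions (m + k))%:R].
Proof.
pose q k : {poly rat} := (Q (m + k) m)%:R.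
(* The three identities are the cases where [f] is the powers of ['X], [bell_poly] and
   [binom_poly 'X]. *)
have convI f : binom_conv q (binom_transform f) n
    = binom_conv (fun k => (num_involutions (m + k))%:R) f n.
  rewrite -binom_conv_transform; apply: eq_binom_conv => // k.
  by rewrite num_involutions_transform.
split.
- rewrite -[RHS]convI; apply: eq_bigr => k _.
  by rewrite binom_transform_exp.
- rewrite -[X in 'X * X]convI mulr_sumr; apply: eq_bigr => k _.
  by rewrite addn1 bell_polyS [RHS]mulrCA.
- under [RHS]eq_bigr => k _ do rewrite mulrAC.
  rewrite -[RHS](convI (binom_poly 'X)); apply: eq_bigr => k _.
  by rewrite mulrAC -[X in binom_poly _ X]add0n binom_poly_Vandermonde.
Qed.
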